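(* Let $G$ be a locally compact, second countable, $\sigma$-compact Abelian group which is not compact. Let $\mu,\nu\in DM$ be almost periodic translation bounded measures on $G$. If $\mu$ and $\nu$ come close to infinity, then $\mu=\nu$.
   Context: $G$ is written additively. $C_u(G)$ is the space of uniformly continuous bounded complex functions on $G$ with the sup-norm, and $C_c(G)$ is its subspace of compactly supported continuous functions. A Radon measure on $G$ is a complex-valued $\sigma$-additive set function $\mu$, defined on relatively compact Borel sets, whose variation $|\mu|$ is finite on every compact set and which is inner regular: for every $\varepsilon>0$ and every relatively compact Borel set $A$ there is a compact $K_\varepsilon\subset A$ with $|\mu|(A\setminus K_\varepsilon)<\varepsilon$. All measures are Radon measures in this sense. Such a measure need not have finite total variation. A measure $\mu$ on $G$ with support $\Lambda$ is discrete if each $\lambda\in\Lambda$ has a neighborhood $\lambda+U$ with $(\lambda+U)\cap\Lambda=\{\lambda\}$; then one writes $\mu=\sum_{\lambda\in\Lambda}\mu(\lambda)\delta_\lambda$ with $\mu(\lambda)\in\mathbb{C}$, where $\delta_\lambda$ is the unit mass at $\lambda$. $\mu$ is translation bounded if $\sup_{t\in G}|\mu|(K+t)<\infty$ for every compact $K\subset G$. A function $g\in C_u(G)$ is almost periodic if the closure of the family of translates $\{g(\cdot-t)\}_{t\in G}$ is a compact subset of $C_u(G)$. A Radon measure $\mu$ on $G$ is almost periodic if for each $f\in C_c(G)$ the function $(f\star\mu)(x)=\int f(x-y)\,d\mu(y)$ is almost periodic on $G$. $DM$ is the class of discrete Radon measures $\mu$ on $G$ such that for some neighborhood $U$ of $0$,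 $\sup_{x\in G}\#\{(x+U)\cap\operatorname{supp}\mu\}<\infty$, where $\#$ denotes the number of points. Discrete measures $\mu=\sum_{\lambda\in\Lambda}\mu(\lambda)\delta_\lambda$ and $\nu=\sum_{\gamma\in\Gamma}\nu(\gamma)\delta_\gamma$, with $\Lambda=\operatorname{supp}\mu$ and $\Gamma=\operatorname{supp}\nu$, come close to infinity if there is a bijection $\sigma:\Lambda\to\Gamma$ such that for every $\varepsilon>0$ and every neighborhood $V$ of $0$ there is a compact $K\subset G$ such that for all $\lambda\in\Lambda$: if $\lambda\in\Lambda\setminus K$ or $\sigma(\lambda)\in\Gamma\setminus K$, then $\lambda-\sigma(\lambda)\in V$ and $|\mu(\lambda)-\nu(\sigma(\lambda))|<\varepsilon$. *)

(* Defs.v *)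
From HB Require Import structures.
From mathcomp Require Import all_boot all_order all_algebra.
From mathcomp Require Import complex.
From mathcomp Require Import all_classical all_reals all_analysis.

Set Implicit Arguments.
Unset Strict Implicit.
Unset Printing Implicit Defensive.

Import Order.TTheory GRing.Theory Num.Theory.
Import numFieldNormedType.Exports ComplexField.Normc.

Local Open Scope classical_set_scope.
Local Open Scope ring_scope.
Local Open Scope complex_scope.

(* Measures are functions [mu : set G -> R[i]] of which only the values on
   relatively compact Borel sets are meaningful; every definition below, and
   equality of measures ([measure_eq]), looks at those values only.
   [R[i]^o] is R[i] seen as a normed space over itself; it is used where the
   topology or the uniform structure of R[i] is needed. *)

Definition translate (G : zmodType) (A : set G) (t : G) : set G :=
  [set a + t | a in A].

Definition sigma_compact (T : topologicalType) : Prop :=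
  exists K : nat -> set T,
    (forall n, compact (K n)) /\ \bigcup_n K n = [set: T].

Definition relcompact_borel (T : topologicalType) (A : set T) : Prop :=
  <<s @open T >> A /\ precompact A.

(* For a relatively compact Borel set A the supremum may equivalently be taken
   over finite Borel partitions of A (add the remainder to the family). For an
   arbitrary A this is the supremum of the variations of the relatively compact
   Borel subsets of A. *)
Definition variation (R : realType) (G : topologicalZmodType)
    (mu : set G -> R[i]) (A : set G) : \bar R :=
  ereal_sup [set v | exists n (F : 'I_n -> set G),
    [/\ forall i, relcompact_borel (F i) /\ F i `<=` A,
        trivIset [set: 'I_n] F &
        v = (\sum_(i < n) normc (mu (F i)))%:E]].

Definition sigma_additive_relcompact (R : realType) (G : topologicalZmodType)
    (mu : set G -> R[i]) : Prop :=
  forall F : nat -> set G,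
    (forall n, relcompact_borel (F n)) -> trivIset [set: nat] F ->
    relcompact_borel (\bigcup_n F n) ->
    (fun n => (\sum_(i < n) mu (F i) : R[i]^o)) @ \oo
      --> (mu (\bigcup_n F n) : R[i]^o).

Definition radon_measure (R : realType) (G : topologicalZmodType)
    (mu : set G -> R[i]) : Prop :=
  [/\ sigma_additive_relcompact mu,
      forall K, compact K -> (variation mu K < +oo)%E &
      forall (e : R) (A : set G), 0 < e -> relcompact_borel A ->
        exists K, [/\ compact K, K `<=` A & (variation mu (A `\` K) < e%:E)%E]].

Definition measure_eq (R : realType) (G : topologicalZmodType)
    (mu nu : set G -> R[i]) : Prop :=
  forall A, relcompact_borel A -> mu A = nu A.

Definition supp (R : realType) (G : topologicalZmodType)
    (mu : set G -> R[i]) : set G :=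
  [set x | forall U, nbhs x U -> (0 < variation mu U)%E].

Definition discrete_measure (R : realType) (G : topologicalZmodType)
    (mu : set G -> R[i]) : Prop :=
  forall l, supp mu l ->
    exists2 U, nbhs (0 : G) U & translate U l `&` supp mu = [set l].

Definition translation_bounded (R : realType) (G : topologicalZmodType)
    (mu : set G -> R[i]) : Prop :=
  forall K, compact K ->
    (ereal_sup [set variation mu (translate K t) | t in [set: G]] < +oo)%E.

Definition unif_continuous_bounded (R : realType) (G : topologicalZmodType)
    (g : G -> R[i]) : Prop :=
  (forall e : R, 0 < e ->
     exists2 V, nbhs (0 : G) V &
       forall x y, V (x - y) -> normc (g x - g y) < e) /\
  (exists M : R, forall x, normc (g x) <= M).

Definition C_u (R : realType) (G : topologicalZmodType) :
    set {uniform G -> R[i]^o} :=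
  [set g | unif_continuous_bounded (g : G -> R[i])].

Definition C_c (R : realType) (G : topologicalZmodType) : set (G -> R[i]^o) :=
  [set f | continuous f /\ compact (closure [set x | f x != 0])].

Definition translates (R : realType) (G : topologicalZmodType)
    (g : G -> R[i]^o) : set {uniform G -> R[i]^o} :=
  range (fun (t : G) (x : G) => g (x - t)).

(* The topology of [{uniform G -> R[i]^o}] is that of uniform convergence, which
   on C_u(G) is the topology of the sup-norm; the closure in the subspace
   C_u(G) is the trace on it of the closure in the whole space. *)
Definition almost_periodic_fun (R : realType) (G : topologicalZmodType)
    (g : G -> R[i]^o) : Prop :=
  C_u g /\
  compact (@C_u R G `&` closure (translates g)).

(* A σ-algebra type generated by a family of sets is only available over a
   pointed type; 0 is the point. *)
Definition pointed_group (G : topologicalZmodType) : Type := G.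

HB.instance Definition _ (G : topologicalZmodType) :=
  Choice.on (pointed_group G).
HB.instance Definition _ (G : topologicalZmodType) :=
  isPointed.Build (pointed_group G) (0 : G).

Definition borel_group (G : topologicalZmodType) :=
  g_sigma_algebraType (@open G : set (set (pointed_group G))).

(* The positive part (Jordan decomposition) of a real-valued measure given on
   the relatively compact Borel sets; it is a positive, locally finite measure
   on all Borel sets. *)
Definition pos_part (R : realType) (G : topologicalZmodType)
    (mu : set G -> R) (A : set (borel_group G)) : \bar R :=
  ereal_sup [set (mu B)%:E | B in [set B : set G |
    relcompact_borel B /\ B `<=` A]].

Definition neg_part (R : realType) (G : topologicalZmodType)
    (mu : set G -> R) : set (borel_group G) -> \bar R :=
  pos_part (fun A => - mu A).

(* Integral of a compactly supported continuous function against a real-valued,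
   then against a complex-valued, Radon measure. For such functions all the
   Lebesgue integrals involved are finite, so [fine] loses nothing. *)
Definition real_integral (R : realType) (G : topologicalZmodType)
    (mu : set G -> R) (f : G -> R) : R :=
  fine (\int[pos_part mu]_(x in [set: borel_group G]) (f x)%:E)%E -
  fine (\int[neg_part mu]_(x in [set: borel_group G]) (f x)%:E)%E.

Definition complex_integral (R : realType) (G : topologicalZmodType)
    (mu : set G -> R[i]) (f : G -> R[i]) : R[i] :=
  let reM A := complex.Re (mu A) in let imM A := complex.Im (mu A) in
  let reF x := complex.Re (f x) in let imF x := complex.Im (f x) in
  (real_integral reM reF - real_integral imM imF) +i*
  (real_integral reM imF + real_integral imM reF).

Definition convolution (R : realType) (G : topologicalZmodType)
    (f : G -> R[i]) (mu : set G -> R[i]) (x : G) : R[i] :=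
  complex_integral mu (fun y => f (x - y)).

Definition almost_periodic_measure (R : realType) (G : topologicalZmodType)
    (mu : set G -> R[i]) : Prop :=
  forall f, @C_c R G f -> almost_periodic_fun (convolution f mu).

Definition DM (R : realType) (G : topologicalZmodType)
    (mu : set G -> R[i]) : Prop :=
  [/\ radon_measure mu, discrete_measure mu &
      exists2 U, nbhs (0 : G) U &
        exists n : nat, forall x, (translate U x `&` supp mu #<= `I_n)%card].

Definition come_close_to_infinity (R : realType) (G : topologicalZmodType)
    (mu nu : set G -> R[i]) : Prop :=
  exists sigma : G -> G,
    set_bij (supp mu) (supp nu) sigma /\
    forall (e : R) (V : set G), 0 < e -> nbhs (0 : G) V ->
      exists2 K, compact K &
        forall l, supp mu l ->
          (supp mu `\` K) l \/ (supp nu `\` K) (sigma l) ->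
          V (l - sigma l) /\ normc (mu [set l] - nu [set sigma l]) < e.

(* Main.v *)
Require Import Defs.
From HB Require Import structures.
From mathcomp Require Import all_boot all_order all_algebra.
From mathcomp Require Import complex ring lra.
From mathcomp Require Import all_classical all_reals all_analysis.
From mathcomp Require Import measurable_realfun.

Set Implicit Arguments.
Unset Strict Implicit.
Unset Printing Implicit Defensive.

Import Order.TTheory GRing.Theory Num.Theory.
Import numFieldNormedType.Exports.

Local Open Scope classical_set_scope.
Local Open Scope ring_scope.
Local Open Scope complex_scope.

(** A measure mu of class DM is the sum of its atoms over its support, which
    meets every translate of a fixed compact set in a bounded number of points
    ([DM_atomic], [DM_count]). Consequently f * mu is, for f continuous with
    compact support, the locally finite sum of the f (x - l) mu(l)
    ([convolution_atomic]); the work there is to identify the Jordan parts of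
    the real and imaginary parts of mu with positive atomic measures
    ([pos_part_atomic]) and to integrate f against these.

    If mu and nu come close to infinity, then pairing the atom l of mu with the
    atom sigma l of nu shows that f * mu - f * nu tends to 0 at infinity: only
    boundedly many pairs contribute at a given x, and far away each of them
    contributes little ([close_convolution_vanish]). On the other hand f * mu
    and f * nu are almost periodic. On a group which is not compact, two almost
    periodic functions have common almost periods outside every compact set, so
    their values at x are almost repeated arbitrarily far away; if their
    difference tends to 0 at infinity they are therefore equal
    ([almost_periodic_eq]).

    Hence f * mu = f * nu for all such f. Since the supports are locally finite,
    f can be chosen with f 0 = 1 and f (l - y) = 0 for all other y in either
    support ([isolating_bump]), and evaluating at l gives mu(l) = nu(l). *)

Local Notation normc := ComplexField.Normc.normc.

(** * Modulus, real and imaginary parts *)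

Lemma normC_normc (R : realType) (z : R[i]) : `|z| = (normc z)%:C.
Proof. by case: z => a b; rewrite normc_def. Qed.

Lemma posC_real (R : realType) (e : R[i]) :
  0 < e -> exists2 r : R, e = r%:C & 0 < r.
Proof. by case: e => a b; rewrite ltcE /= => /andP[/eqP -> a0]; exists a. Qed.

Lemma normc_lt (R : realType) (z : R[i]) (e : R) :
  (`|z| < e%:C) = (normc z < e).
Proof. by rewrite normC_normc ltcR. Qed.

Lemma normc_ge0 (R : realType) (z : R[i]) : 0 <= normc z.
Proof. by rewrite -lecR -normC_normc; exact: (normr_ge0 z). Qed.

Lemma ler_normcD (R : realType) (x y : R[i]) :
  normc (x + y) <= normc x + normc y.
Proof. exact: (@le_normcD R x y). Qed.

Lemma normc_opp (R : realType) (x : R[i]) : normc (- x) = normc x.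
Proof. exact: (@normcN R x). Qed.

Lemma normc_sum_le (R : realType) (I : eqType) (s : seq I) (F : I -> R[i])
    (c : R) :
  (forall i, i \in s -> normc (F i) <= c) ->
  normc (\sum_(i <- s) F i) <= c *+ size s.
Proof.
elim: s => [|i s IH] Fc; first by rewrite big_nil ComplexField.Normc.normc0.
rewrite big_cons /= mulrS (le_trans (ler_normcD _ _))// lerD ?Fc ?mem_head//.
by apply: IH => j js; rewrite Fc// inE js orbT.
Qed.

Lemma normr_Re (R : realType) (z : R[i]) : `|complex.Re z| <= normc z.
Proof. by case: z => x y /=; rewrite -sqrtr_sqr ler_wsqrtr// lerDl sqr_ge0. Qed.

Lemma normr_Im (R : realType) (z : R[i]) : `|complex.Im z| <= normc z.
Proof. by case: z => x y /=; rewrite -sqrtr_sqr ler_wsqrtr// lerDr sqr_ge0. Qed.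

Lemma continuous_Re (R : realType) :
  continuous (fun z : R[i]^o => complex.Re z).
Proof.
move=> z A /= /nbhs_ballP[e /= e0 eA].
suff : nbhs (z : R[i]^o) ((@complex.Re R) @^-1` A) by [].
apply/nbhs_ballP; exists e%:C; first by rewrite /= ltcR.
move=> y /= zy; apply: eA; move: zy; rewrite -!ball_normE /= normc_lt => zy.
rewrite (le_lt_trans _ zy)// (le_trans _ (normr_Re _))//.
by case: z y {zy} => a b [].
Qed.

Lemma continuous_Im (R : realType) :
  continuous (fun z : R[i]^o => complex.Im z).
Proof.
move=> z A /= /nbhs_ballP[e /= e0 eA].
suff : nbhs (z : R[i]^o) ((@complex.Im R) @^-1` A) by [].
apply/nbhs_ballP; exists e%:C; first by rewrite /= ltcR.
move=> y /= zy; apply: eA; move: zy; rewrite -!ball_normE /= normc_lt => zy.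
rewrite (le_lt_trans _ zy)// (le_trans _ (normr_Im _))//.
by case: z y {zy} => a b [].
Qed.

(** * Compactness in topological groups *)

(** If K failed, the sets A for which P (K `\` A) holds would form a proper
    filter containing K; a cluster point of it in K contradicts the local
    hypothesis. *)
Lemma compact_ind (T : topologicalType) (P : set T -> Prop) (K : set T) :
  compact K -> P set0 ->
  (forall A B, A `<=` B -> P B -> P A) ->
  (forall A B, P A -> P B -> P (A `|` B)) ->
  (forall x, K x -> exists2 U, nbhs x U & P U) ->
  P K.
Proof.
move=> cK P0 PS PU Ploc; apply: contrapT => nPK.
pose F : set_system T := [set A | P (K `\` A)].
have FF : ProperFilter F.
  split; first by rewrite /F/= setD0.
  split; first by rewrite /F/= setDT.
    by move=> A B FA FB; rewrite /F/= setDIr; exact: PU.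
  by move=> A B AB; apply: PS; exact: setDS.
have [|x [Kx clx]] := cK F FF; first by rewrite /F/= setDv.
have [U nU PU'] := Ploc x Kx.
have FU : F (~` U) by rewrite /F/= setDE setCK; apply: PS PU' => y [].
by have [y []] := clx _ _ FU nU.
Qed.

Lemma nbhs_sub0 (G : topologicalZmodType) (x : G) (V : set G) :
  nbhs (0 : G) V -> nbhs x [set y | V (y - x)].
Proof.
move=> nV; have cx : (fun y : G => y - x) @ x --> (x - x : G).
  apply: (@continuous_comp _ _ _ (fun y : G => (y, x))
    (fun p : G * G => p.1 - p.2)); last exact: sub_continuous.
  by apply: cvg_pair => /=; [exact: cvg_id|exact: cvg_cst].
by apply: cx; rewrite subrr.
Qed.

Lemma nbhs_add0 (G : topologicalZmodType) (x : G) (V : set G) :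
  nbhs x V -> nbhs (0 : G) [set y | V (x + y)].
Proof.
move=> nV; have cx : (fun y : G => x + y) @ (0 : G) --> (x + 0 : G).
  apply: (@continuous_comp _ _ _ (fun y : G => (x, y))
    (fun p : G * G => p.1 + p.2)); last exact: add_continuous.
  by apply: cvg_pair => /=; [exact: cvg_cst|exact: cvg_id].
by apply: cx; rewrite addr0.
Qed.

Lemma nbhs_opp0 (G : topologicalZmodType) (V : set G) :
  nbhs (0 : G) V -> nbhs (0 : G) [set y | V (- y)].
Proof.
move=> nV; have cx : -%R @ (0 : G) --> (- 0 : G) by exact: opp_continuous.
by apply: cx; rewrite oppr0.
Qed.

Lemma continuous_reflect (G : topologicalZmodType) (x : G) :
  continuous (fun y : G => x - y).
Proof.
move=> y; apply: (@continuous_comp _ _ _ (fun y : G => (x, y))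
    (fun p : G * G => p.1 - p.2)); last exact: sub_continuous.
by apply: cvg_pair => /=; [exact: cvg_cst|exact: cvg_id].
Qed.

Lemma compact_reflect (G : topologicalZmodType) (x : G) (K : set G) :
  compact K -> compact [set y | K (x - y)].
Proof.
move=> cK; have -> : [set y | K (x - y)] = (fun y => x - y) @` K.
  apply/seteqP; split=> y /=; last by move=> [z Kz <-]; rewrite subKr.
  by move=> Ky; exists (x - y) => //; rewrite subKr.
apply: continuous_compact => //; apply: continuous_subspaceT.
exact: continuous_reflect.
Qed.

Lemma compact_add (G : topologicalZmodType) (A B : set G) :
  compact A -> compact B -> compact [set x | exists2 a, A a & B (x - a)].
Proof.
move=> cA cB.
have -> : [set x | exists2 a, A a & B (x - a)] =
    (fun p : G * G => p.1 + p.2) @` (A `*` B).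
  apply/seteqP; split=> x /=.
    by move=> [a Aa Bxa]; exists (a, x - a) => //=; rewrite addrC subrK.
  by move=> [[a b] [/= Aa Bb] <-]; exists a => //; rewrite addrC addKr.
apply: continuous_compact; last exact: compact_setX.
by apply: continuous_subspaceT; exact: add_continuous.
Qed.

(** Continuity of (x, v) |-> f (x + v) - f x at the points (x, 0) with x in K,
    together with compactness of K, gives a neighbourhood of 0 that works for
    all x in K at once. Two points outside K have equal values, and if just one
    of x, y lies in K it serves as base point, after replacing v by - v. *)
Lemma compact_support_unif_continuous (R : realType) (G : topologicalZmodType)
    (f : G -> R[i]^o) (K : set G) :
  continuous f -> compact K -> (forall x, ~ K x -> f x = 0) ->
  forall e : R, 0 < e -> exists2 V, nbhs (0 : G) V &
    forall x y, V (x - y) -> normc (f x - f y : R[i]) < e.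
Proof.
move=> cf cK f0 e e0.
pose P (v x : G) := normc (f (x + v) - f x : R[i]) < e.
have nK : \forall v \near (0 : G), K `<=` P v.
  move/compact_near_coveringP: cK; apply.
  move=> x _.
  have : (fun p : G * G => f (p.1 + p.2) - f p.1) @ (x, 0 : G) -->
      (f (x + 0) - f x : R[i]^o).
    apply: cvgB.
      apply: (cvg_comp _ f); last exact: cf.
      exact: (@add_continuous G (x, 0)).
    by apply: (cvg_comp _ f); [exact: cvg_fst|exact: cf].
  rewrite addr0 subrr => /cvgr0_norm_lt /(_ e%:C).
  rewrite ltcR => /(_ e0) H.
  near=> p; rewrite /P /= -normc_lt.
  by near: p; exact: H.
exists [set v | K `<=` P v /\ K `<=` P (- v)].
  apply: filterI => //; exact: (nbhs_opp0 nK).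
move=> x y /= [K1 K2].
have [Ky|nKy] := pselect (K y).
  by have := K1 y Ky; rewrite /P (addrC y) subrK.
have [Kx|nKx] := pselect (K x).
  by have := K2 x Kx; rewrite /P opprB (addrC x) subrK -opprB normc_opp.
by rewrite !f0// subrr ComplexField.Normc.normc0.
Unshelve. all: by end_near. Qed.

(** Boundedness is local by uniform continuity, so it passes to K by
    [compact_ind]. *)
Lemma compact_support_bounded (R : realType) (G : topologicalZmodType)
    (f : G -> R[i]^o) (K : set G) :
  continuous f -> compact K -> (forall x, ~ K x -> f x = 0) ->
  exists C : R, forall x, normc (f x) <= C.
Proof.
move=> cf cK fK.
have [C fC] : exists C : R, forall x, K x -> normc (f x) <= C.
  apply: (@compact_ind _
    (fun N => exists C : R, forall x, N x -> normc (f x) <= C) K) => //.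
  - by exists 0.
  - by move=> A B AB [C BC]; exists C => x /AB; exact: BC.
  - move=> A B [C AC] [D BD]; exists (Num.max C D) => x; rewrite le_max.
    by move=> [/AC ->//|/BD ->]; rewrite orbT.
  move=> x _.
  have [V nV fV] := compact_support_unif_continuous cf cK fK ltr01.
  exists [set y | V (y - x)]; first exact: nbhs_sub0.
  exists (normc (f x) + 1) => y /fV /ltW fyx.
  by rewrite -(subrK (f x) (f y)) addrC (le_trans (ler_normcD _ _))// lerD2l.
exists (Num.max C 0) => x; rewrite le_max.
have [/fC ->//|/fK ->] := pselect (K x).
by rewrite ComplexField.Normc.normc0 lexx orbT.
Qed.

(** A locally compact Hausdorff space is completely regular, so 0 can be
    separated from the complement of a neighbourhood contained in W and in a
    compact set; the latter makes the support compact. *)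
Lemma exists_bump (R : realType) (G : topologicalZmodType) (W : set G) :
  hausdorff_space G -> locally_compact [set: G] -> nbhs (0 : G) W ->
  exists f : G -> R[i]^o, [/\ @C_c R G f, f 0 = 1 & forall x, ~ W x -> f x = 0].
Proof.
move=> hG lG nW.
have [K nK [cK clK]] := lG 0 I; rewrite withinET in nK.
(* f is 0 at 0 and 1 off W', so 1 - f is the bump. *)
pose W' := interior (W `&` K).
have W'0 : W' 0 by rewrite /W' /interior /=; exact: filterI.
have sepW : uniform_separator [set 0] (~` W').
  apply: (@locally_compact_completely_regular _ R lG hG) => /=.
    by apply: open_closedC; exact: open_interior.
  by move=> /(_ W'0).
have [f [cf _ f0 f1]] := (@uniform_separatorP _ R [set 0] (~` W')).1 sepW.
pose g x : R[i]^o := (1 - f x)%:C.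
have g0 x : ~ W' x -> g x = 0.
  move=> nWx; rewrite /g.
  have -> : f x = 1 by apply: f1; exists x.
  by rewrite subrr.
exists g; split.
- split.
    move=> x.
    have h : (fun y => 1 - f y) @ x --> (1 - f x).
      by apply: cvgB; [exact: cvg_cst|exact: cf].
    apply: (cvg_comp _ (fun r : R => r%:C : R[i]^o) h).
    apply/cvgrPdist_lt => e /posC_real[r -> r0].
    near=> y.
    rewrite -rmorphB /= normc_def /= expr0n addr0 sqrtr_sqr ltcR.
    by near: y; apply: cvgr_dist_lt.
  apply: (subclosed_compact _ cK); first exact: closed_closure.
  rewrite [X in _ `<=` X](closure_id K).1//; apply: closureS.
  move=> x /= /eqP gx; apply: contrapT => nKx; apply: gx; apply: g0.
  by move/interior_subset => -[].
- rewrite /g; have -> : f 0 = 0 by apply: f0; exists 0.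
  by rewrite subr0.
- by move=> x nWx; apply: g0 => /interior_subset[].
Unshelve. all: by end_near. Qed.

(** Only finitely many points of L lie in the compact l - K, hence a
    neighbourhood of 0 avoids all l - y with y in L, y <> l. Convolving a
    measure carried by L with such an f reads off its atom at l. *)
Lemma isolating_bump (R : realType) (G : topologicalZmodType) (L : set G)
    (l : G) :
  hausdorff_space G -> locally_compact [set: G] ->
  (forall K, compact K -> finite_set (K `&` L)) ->
  exists f : G -> R[i]^o, [/\ @C_c R G f, f 0 = 1 &
    forall y, L y -> y <> l -> f (l - y) = 0].
Proof.
move=> hG lG finL.
have [K nK [cK clK]] := lG 0 I; rewrite withinET in nK.
have cK' : compact [set y | K (l - y)] by exact: compact_reflect.
pose F := ([set y | K (l - y)] `&` L) `\ l.
have fF : finite_set F by apply: sub_finite_set (finL _ cK') => y [].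
have clF : closed F by apply: compact_closed => //; exact: finite_compact.
have nF : nbhs l (~` F).
  by apply: open_nbhs_nbhs; split; [rewrite openC|move=> [_]; exact].
have nW : nbhs (0 : G) (K `&` [set v | ~ F (l - v)]).
  by apply: filterI => //; exact: nbhs_opp0 (nbhs_add0 nF).
have [f [fc f0 fW]] := exists_bump R hG lG nW.
exists f; split=> // y Ly yl; apply: fW => -[Ky] /=; rewrite subKr; apply.
by split.
Qed.

(** * Almost periodic functions that agree at infinity *)

(** The translates of g lie in a compact set, so along any filter F on the group
    they have a cluster point p in the uniform topology; restricting F to the t
    whose translate is e / 2 close to p keeps the filter proper. The refined
    filter can be refined again for another function, which yields translations
    that are almost periods of several functions simultaneously. *)
Lemma almost_periodic_refine (R : realType) (G : topologicalZmodType)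
    (g : G -> R[i]^o) (F : set_system G) (e : R) :
  almost_periodic_fun g -> ProperFilter F -> 0 < e ->
  exists F' : set_system G, [/\ ProperFilter F', F `<=` F' &
    exists2 B, F' B & forall s t x, B s -> B t ->
      normc (g (x - s) - g (x - t) : R[i]) < e].
Proof.
move=> [[gu [M gM]] cg] FF e0.
pose phi (t : G) : {uniform G -> R[i]^o} := fun x => g (x - t).
pose A := @C_u R G `&` closure (translates g).
have phiA t : A (phi t).
  split; last by apply: subset_closure; exists t.
  split; last by exists M => x; exact: gM.
  move=> r r0; have [V nV gV] := gu r r0; exists V => // x y Vxy.
  by apply: gV; rewrite opprB addrA subrK.
have [p [_ clp]] : A `&` cluster (fmap phi F) !=set0.
  apply: cg; apply: (@filterS _ F _ setT) => [t _|]; first exact: phiA.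
  exact: filterT.
pose B := [set t | forall x, normc (p x - phi t x : R[i]) < e / 2].
exists (within B F); split.
- apply: Build_ProperFilter_ex => C FC.
  have nB : nbhs p [set h : {uniform G -> R[i]^o} |
      forall x, normc (p x - h x : R[i]) < e / 2].
    apply/uniform_nbhs.
    exists [set xy : R[i]^o * R[i]^o | normc (xy.1 - xy.2 : R[i]) < e / 2].
    split; last by move=> h hB x; exact: hB.
    rewrite -entourage_ballE; exists ((e / 2)%:C) => /=.
      by rewrite ltcR divr_gt0.
    by move=> [a b] /=; rewrite -ball_normE /= normc_lt.
  have FC' : fmap phi F (phi @` [set t | B t -> C t]).
    by apply: (@filterS _ F _ [set t | B t -> C t]) => // t Ct; exists t.
  have [_ [[t Ct <-] Bt]] := clp _ _ FC' nB.
  by exists t; apply: Ct.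
- by move=> C FC; apply: filterS FC => t Ct _.
exists B; first by apply: (@filterS _ F _ setT) => //; exact: filterT.
move=> s t x Bs Bt.
have -> : g (x - s) - g (x - t) = - (p x - phi s x) + (p x - phi t x).
  by rewrite opprB addrA subrK.
rewrite (le_lt_trans (ler_normcD _ _))// normc_opp (splitr e).
by apply: ltrD; [exact: Bs|exact: Bt].
Qed.

(** Start from the filter of complements of compact sets, proper because G is
    not compact, and refine it for g1 and then for g2. This provides s and, with
    s fixed, a t such that t - s is a common almost period of g1 and g2 which
    moves x out of any prescribed compact set, to a point where g1 and g2 are
    close. Hence g1 x and g2 x are close as well. *)
Lemma almost_periodic_eq (R : realType) (G : topologicalZmodType)
    (g1 g2 : G -> R[i]^o) :
  ~ compact [set: G] -> almost_periodic_fun g1 -> almost_periodic_fun g2 ->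
  (forall e : R, 0 < e -> exists2 K : set G, compact K &
     forall x, ~ K x -> normc (g1 x - g2 x : R[i]) < e) ->
  forall x, g1 x = g2 x.
Proof.
move=> nG ap1 ap2 g12 x.
apply/eqP; rewrite -subr_eq0; apply/eqP/(@ComplexField.Normc.eq0_normc R).
apply/eqP; rewrite eq_le normc_ge0 andbT.
apply/ler_addgt0Pr => e e0; rewrite add0r.
have e3 : 0 < e / 3 by rewrite divr_gt0.
have [K cK gK] := g12 _ e3.
pose F0 := filter_from [set C : set G | compact C] setC.
have FF0 : ProperFilter F0.
  apply: filter_from_proper.
    apply: filter_from_filter; first by exists set0; exact: compact0.
    move=> A B cA cB; exists (A `|` B); first exact: compactU.
    by rewrite setCU.
  move=> A cA; apply/set0P/eqP => A0; apply: nG.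
  by rewrite -setC0 -A0 setCK.
have [F1 [FF1 F01 [B1 FB1 gB1]]] := almost_periodic_refine ap1 FF0 e3.
have [F2 [FF2 F12 [B2 FB2 gB2]]] := almost_periodic_refine ap2 FF1 e3.
have FB : F2 (B1 `&` B2) by apply: filterI => //; exact: F12.
have [s [B1s B2s]] := filter_ex FB.
have cKs : compact [set t | K (x + s - t)] by exact: compact_reflect.
have FK : F2 (~` [set t | K (x + s - t)]).
  by apply/F12/F01; exists [set t | K (x + s - t)].
have [t [[B1t B2t] nKt]] := filter_ex (filterI FB FK).
(* Translating by s and by t at the point x + s compares x with x + s - t. *)
have h1 := gB1 _ _ (x + s) B1s B1t; have h2 := gB2 _ _ (x + s) B2s B2t.
have h := gK _ nKt.
rewrite addrK in h1 h2.
pose y := x + s - t; rewrite -/y in h1 h2 h.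
have -> : g1 x - g2 x = (g1 x - g1 y) + (- (g2 x - g2 y) + (g1 y - g2 y)).
  by rewrite opprB; ring.
rewrite (le_trans (ler_normcD _ _))//.
have := ler_normcD (- (g2 x - g2 y)) (g1 y - g2 y).
rewrite normc_opp; move: h1 h2 h.
by move: (normc _) (normc _) (normc _) (normc _) => a b c d; lra.
Qed.

(** * Relatively compact Borel sets, and additivity on them *)

Section relcompact_borel_sets.
Context (G : topologicalZmodType).
Hypothesis G_hausdorff : hausdorff_space G.
Implicit Types A B : set G.

Lemma borel_open A : open A -> @measurable _ (borel_group G) A.
Proof. by move=> oA; apply: sub_sigma_algebra. Qed.

Lemma borel_closed A : closed A -> @measurable _ (borel_group G) A.
Proof.
move=> cA; rewrite -(setCK A); apply: (@measurableC _ (borel_group G)).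
by apply: borel_open; rewrite openC.
Qed.

Lemma relcompact_borel_sub A B :
  relcompact_borel B -> @measurable _ (borel_group G) A -> A `<=` B ->
  relcompact_borel A.
Proof. by move=> [_ pB] mA AB; split=> //; exact: precompact_subset pB. Qed.

Lemma relcompact_borelI A B :
  relcompact_borel A -> @measurable _ (borel_group G) B ->
  relcompact_borel (A `&` B).
Proof.
move=> rA mB; apply: (relcompact_borel_sub rA); last by move=> x [].
by apply: (@measurableI _ (borel_group G)) => //; exact: rA.1.
Qed.

Lemma relcompact_borelD A B :
  relcompact_borel A -> @measurable _ (borel_group G) B ->
  relcompact_borel (A `\` B).
Proof. by move=> rA mB; apply: relcompact_borelI => //; exact: measurableC. Qed.

Lemma relcompact_borelU A B :
  relcompact_borel A -> relcompact_borel B -> relcompact_borel (A `|` B).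
Proof.
move=> [mA pA] [mB pB]; split.
  exact: (@measurableU _ (borel_group G) A B mA mB).
rewrite precompactE closureU; apply: compactU; by rewrite -precompactE.
Qed.

Lemma relcompact_borel_compact A : compact A -> relcompact_borel A.
Proof.
move=> cA; split; first by apply: borel_closed; exact: compact_closed.
exact: compact_precompact.
Qed.

Lemma relcompact_borel_finite A : finite_set A -> relcompact_borel A.
Proof. by move=> fA; apply/relcompact_borel_compact/finite_compact. Qed.

End relcompact_borel_sets.

Lemma normc_le_variation (R : realType) (G : topologicalZmodType)
    (mu : set G -> R[i]) (A B : set G) :
  relcompact_borel B -> B `<=` A ->
  ((normc (mu B))%:E <= Defs.variation mu A)%E.
Proof.
move=> rB BA; apply: ereal_sup_ubound; exists 1%N, (fun=> B); split => //.
  by move=> i j _ _ _; rewrite !ord1.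
by rewrite big_ord1.
Qed.

(** The translates of the compact set {0} are the singletons. *)
Lemma translation_bounded_atoms (R : realType) (G : topologicalZmodType)
    (mu : set G -> R[i]) : hausdorff_space G -> translation_bounded mu ->
  exists M : R, forall x, normc (mu [set x]) <= M.
Proof.
move=> G_hausdorff /(_ [set 0] (@compact_set1 _ _)).
set v := ereal_sup _ => vy.
have le_v x : ((normc (mu [set x]))%:E <= v)%E.
  apply: ereal_sup_ge; exists (Defs.variation mu (translate [set 0] x)).
    by exists x.
  apply: normc_le_variation; first exact: relcompact_borel_finite.
  by move=> _ ->; exists 0 => //; rewrite add0r.
exists (fine v) => x; rewrite -lee_fin fineK//.
by rewrite ge0_fin_numE// (le_trans _ (le_v 0))// lee_fin normc_ge0.
Qed.

Section additivity.
Context (R : realType) (G : topologicalZmodType) (mu : set G -> R[i]).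
Hypothesis G_hausdorff : hausdorff_space G.
Hypothesis mu_sigma : sigma_additive_relcompact mu.

(** The constant sequence of empty sets makes the partial sums n * mu set0
    converge, so that their increments, all equal to mu set0, tend to 0. *)
Lemma sigma_additive_set0 : mu set0 = 0.
Proof.
have r0 : relcompact_borel (set0 : set G) by apply: relcompact_borel_finite.
have := mu_sigma (F := fun=> set0) (fun=> r0).
rewrite bigcup0// => /(_ _ r0) cvg0.
have {}cvg0 : (fun n => (\sum_(i < n) mu set0 : R[i]^o)) @ \oo
    --> (mu set0 : R[i]^o).
  by apply: cvg0 => i j _ _ [x []].
have : (fun n =>
      (\sum_(i < n.+1) mu set0 - \sum_(i < n) mu set0 : R[i]^o)) @ \oo
    --> (mu set0 - mu set0 : R[i]^o).
  apply: cvgB => //.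
  rewrite -(cvg_shiftS (fun n => (\sum_(i < n) mu set0 : R[i]^o))) in cvg0.
  exact: cvg0.
rewrite subrr.
under eq_fun do rewrite big_ord_recr /= addrAC subrr add0r.
by move=> /(cvg_lim (@norm_hausdorff _ _)); rewrite lim_cst.
Qed.

Lemma sigma_additiveU A B : relcompact_borel A -> relcompact_borel B ->
  A `&` B = set0 -> mu (A `|` B) = mu A + mu B.
Proof.
move=> rA rB AB0.
have r0 : relcompact_borel (set0 : set G) by apply: relcompact_borel_finite.
pose F n := if n == 0%N then A else if n == 1%N then B else set0.
have UF : \bigcup_n F n = A `|` B.
  apply/seteqP; split=> x; first by move=> [[|[|n]] _] //=; [left|right].
  by move=> [Ax|Bx]; [exists 0%N|exists 1%N].
have := mu_sigma (F := F); rewrite UF => H.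
have {}H : (fun n => (\sum_(i < n) mu (F i) : R[i]^o)) @ \oo
    --> (mu (A `|` B) : R[i]^o).
  apply: H; last exact: relcompact_borelU.
    by move=> [|[|n]].
  move=> [|[|i]] [|[|j]] _ _ //=; rewrite /F/=; try by move=> [x []].
    by rewrite AB0 => -[x []].
  by rewrite setIC AB0 => -[x []].
have H2 : (fun n => (\sum_(i < n) mu (F i) : R[i]^o)) @ \oo
    --> (mu A + mu B : R[i]^o).
  (* From the second partial sum on, all terms are mu set0. *)
  rewrite -(cvg_shiftn 2); apply: cvg_near_cst; apply: nearW => n.
  rewrite /= addn2 2!big_ord_recl big1 /F /= ?addr0 //.
  by move=> i _; exact: sigma_additive_set0.
exact: (cvg_unique (@norm_hausdorff _ _) H H2).
Qed.

Lemma sigma_additive_seq (s : seq G) : uniq s ->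
  mu [set` s] = \sum_(x <- s) mu [set x].
Proof.
elim: s => [_|x s IH] /=.
  by rewrite big_nil -sigma_additive_set0; congr mu; apply/seteqP; split=> y.
move=> /andP[xs us]; rewrite big_cons -IH// -sigma_additiveU; last 3 first.
- exact: relcompact_borel_finite.
- by apply: relcompact_borel_finite.
- by apply/seteqP; split=> y //= [->]; rewrite (negbTE xs).
congr mu; apply/seteqP; split=> y /=; rewrite inE.
  by move=> /orP[/eqP|]; [left|right].
by move=> [->|->]; rewrite ?eqxx ?orbT.
Qed.

End additivity.

(** * Measures of class DM are sums of their atoms *)

Section radon.
Context (R : realType) (G : topologicalZmodType) (mu : set G -> R[i]).
Hypothesis G_hausdorff : hausdorff_space G.
Hypothesis mu_radon : radon_measure mu.

Let mu_sigma : sigma_additive_relcompact mu. Proof. by have [] := mu_radon. Qed.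

Lemma radon_splitI A B : relcompact_borel A ->
  @measurable _ (borel_group G) B -> mu A = mu (A `&` B) + mu (A `\` B).
Proof.
move=> rA mB; rewrite -{1}(setUIDK A B) sigma_additiveU//.
- exact: relcompact_borelI.
- exact: relcompact_borelD.
- by apply/seteqP; split=> x //= [[_ Bx] [_ /(_ Bx)]].
Qed.

(** Points off the support have neighbourhoods of variation 0; passing to the
    interior gives open sets, with which other sets can be split. *)
Lemma not_supp_null_nbhs x : ~ supp mu x ->
  exists2 V : set G, open V /\ V x &
    forall B, relcompact_borel B -> B `<=` V -> mu B = 0.
Proof.
move=> /existsNP[U /not_implyP[nU /negP]]; rewrite -leNgt => vU.
exists (interior U); first by split=> //; exact: open_interior.
move=> B rB BO; apply: (@ComplexField.Normc.eq0_normc R).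
apply/eqP; rewrite eq_le normc_ge0 andbT -lee_fin.
apply: le_trans vU; apply: normc_le_variation => //.
by apply: subset_trans BO _; exact: interior_subset.
Qed.

(** Having an open null neighbourhood passes to subsets and to unions, since a
    set in a union of two open sets splits along the first of them. *)
Lemma radon_null_compact (K : set G) :
  compact K -> K `&` supp mu = set0 -> mu K = 0.
Proof.
move=> cK K0.
pose P N := exists V, [/\ open V, N `<=` V &
  forall B, relcompact_borel B -> B `<=` V -> mu B = 0].
have [V [_ KO O0]] : P K; last first.
  by apply: O0 => //; exact: relcompact_borel_compact.
apply: (compact_ind cK).
- exists set0; split=> //; first exact: open0.
  by move=> B _; rewrite subset0 => ->; exact: sigma_additive_set0.
- move=> A B AB [V [oV BV V0]]; exists V; split=> //.
  exact: subset_trans BV.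
- move=> A B [V1 [oV1 AV1 V10]] [V2 [oV2 BV2 V20]].
  exists (V1 `|` V2); split; first exact: openU.
    exact: setUSS.
  move=> C rC CO; have mO := borel_open oV1.
  rewrite (radon_splitI rC mO) V10 ?V20 ?addr0//.
  + exact: relcompact_borelD.
  + by move=> x [/CO[]].
  + exact: relcompact_borelI.
- move=> x Kx; have nx : ~ supp mu x.
    by move=> sx; move: K0; rewrite -subset0 => /(_ x); apply.
  have [V [oO Ox] O0] := not_supp_null_nbhs nx.
  by exists V; [exact: open_nbhs_nbhs|exists V; split].
Qed.

(** By inner regularity A is, up to a set of small variation, a compact set that
    misses the support. *)
Lemma radon_null A : relcompact_borel A -> A `&` supp mu = set0 -> mu A = 0.
Proof.
move=> rA A0; apply: (@ComplexField.Normc.eq0_normc R).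
apply/eqP; rewrite eq_le normc_ge0 andbT.
apply/ler_addgt0Pr => e e0; rewrite add0r -lee_fin.
have [_ _ inreg] := mu_radon.
have [K [cK KA vK]] := inreg e A e0 rA.
have mK : @measurable _ (borel_group G) K.
  by apply: borel_closed; exact: compact_closed.
rewrite (radon_splitI rA mK) (setIidr KA) radon_null_compact//; last first.
  by apply/seteqP; split=> // x [/KA Ax sx]; rewrite -A0.
rewrite add0r; apply: le_trans (ltW vK); apply: normc_le_variation => //.
exact: relcompact_borelD.
Qed.

End radon.

(** A form of pure atomicity over a locally finite set L of candidate atoms that
    is stable under additive maps (opposite, real and imaginary parts); L need
    not be the exact set of atoms. *)
Definition atomic_on (V : zmodType) (G : topologicalZmodType) (L : set G)
    (m : set G -> V) : Prop :=
  forall A, relcompact_borel A ->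
    finite_set (A `&` L) /\ m A = \sum_(x \in A `&` L) m [set x].

Lemma atomic_on_set1 (V : zmodType) (G : topologicalZmodType) (L : set G)
    (m : set G -> V) (x : G) :
  hausdorff_space G ->
  atomic_on L m -> ~ L x -> m [set x] = 0.
Proof.
move=> G_hausdorff mL nLx.
have [_ ->] := mL _ (relcompact_borel_finite G_hausdorff (finite_set1 x)).
by rewrite (_ : _ `&` _ = set0) ?fsbig_set0//; apply/seteqP; split=> // y [->].
Qed.

Lemma atomic_onE (V : zmodType) (G : topologicalZmodType) (L : set G)
    (m : set G -> V) (A : set G) :
  hausdorff_space G -> atomic_on L m -> relcompact_borel A ->
  m A = \sum_(x \in A) m [set x].
Proof.
move=> G_hausdorff mL rA; have [fA ->] := mL A rA; apply: fsbig_widen.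
  by move=> x [].
by move=> x [Ax nx]; apply: (atomic_on_set1 G_hausdorff mL) => Lx; apply: nx.
Qed.

Section uniformly_locally_finite.
Context (R : realType) (G : topologicalZmodType) (mu : set G -> R[i]).
Hypothesis G_hausdorff : hausdorff_space G.
Hypothesis mu_DM : DM mu.

(** Near each point of K the bound is the one in the definition of DM, and it
    adds up over unions. The set x - K is used because f (x - l) is nonzero only
    for l in such a set when f is supported in K; uniformity in x is what makes
    the error terms of the convolutions small. *)
Lemma DM_count (K : set G) : compact K ->
  exists N : nat, forall x, exists s : seq G,
  (size s <= N)%N /\ forall l, supp mu l -> K (x - l) -> l \in s.
Proof.
move=> cK; have [_ _ [U nU [n Un]]] := mu_DM.
apply: (@compact_ind _ (fun K => exists N : nat, forall x, exists s : seq G,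
  (size s <= N)%N /\ forall l, supp mu l -> K (x - l) -> l \in s) K) => //.
- by exists 0%N => x; exists [::]; split.
- move=> A B AB [N BN]; exists N => x; have [s [sN sB]] := BN x.
  by exists s; split=> // l sl /AB; exact: sB.
- move=> A B [N1 AN1] [N2 BN2]; exists (N1 + N2)%N => x.
  have [s1 [sN1 sA]] := AN1 x; have [s2 [sN2 sB]] := BN2 x.
  exists (s1 ++ s2); split; first by rewrite size_cat leq_add.
  move=> l sl; rewrite mem_cat => -[/(sA _ sl) ->//|/(sB _ sl) ->].
  by rewrite orbT.
move=> y _; exists [set z | U (y - z)].
  have := nbhs_sub0 y (nbhs_opp0 nU); apply: filterS => z /=.
  by rewrite opprB.
exists n => x.
pose A := translate U (x - y) `&` supp mu.
have fA : finite_set A by apply: card_le_finite (Un _) (finite_II n).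
exists (finmap.enum_fset (fset_set A)); split.
  have [m Am] := (finite_setP A).1 fA.
  rewrite (card_fset_set Am) -card_le_II.
  by have /card_eqPle[_ mA] := Am; exact: card_le_trans mA (Un _).
move=> l sl /= Ul; rewrite in_fset_set// inE; split => //.
exists (y - (x - l)) => //.
by rewrite opprB -addrA subrKA addrC subrK.
Qed.

Lemma DM_compact_finite (K : set G) : compact K -> finite_set (K `&` supp mu).
Proof.
move=> cK.
have [N /(_ 0)[s [_ sK]]] := DM_count (compact_reflect (x := 0) cK).
apply: (@sub_finite_set _ _ [set` s]) => // l [Kl sl] /=.
by apply: sK => //=; rewrite !sub0r opprK.
Qed.

Lemma DM_relcompact_finite A : relcompact_borel A -> finite_set (A `&` supp mu).
Proof.
move=> [_]; rewrite precompactE => /DM_compact_finite.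
by apply: sub_finite_set; apply: setSI; exact: subset_closure.
Qed.

(** A relatively compact set contains finitely many points of the support; what
    is left of it after removing them is null. *)
Lemma DM_atomic : atomic_on (supp mu) mu.
Proof.
move=> A rA; have fA := DM_relcompact_finite rA; split => //.
have [mu_radon _ _] := mu_DM; have [mu_sigma _ _] := mu_radon.
have mS : @measurable _ (borel_group G) (A `&` supp mu).
  by have [] := relcompact_borel_finite G_hausdorff fA.
rewrite fsbig_finite// -sigma_additive_seq ?finmap.fset_uniq//.
have -> : [set` finmap.enum_fset (fset_set (A `&` supp mu))] = A `&` supp mu.
  by rewrite -[RHS](fset_setK fA).
rewrite (radon_splitI G_hausdorff mu_radon rA mS) setIA setIid.
rewrite (radon_null G_hausdorff mu_radon (A := A `\` _)) ?addr0//.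
  exact: relcompact_borelD.
by apply/seteqP; split=> x // [[Ax nx] sx]; apply: nx.
Qed.

End uniformly_locally_finite.

(** * Convolution with an atomic measure is a locally finite sum *)

Section atom_measure.
Context (R : realType) (G : topologicalZmodType) (a : G -> R).

(** The positive measure with mass [Num.max (a x) 0] at each x. Taking positive
    parts inside the definition makes it a measure for every a, and it is the
    Jordan positive part of the measure with atoms a. *)
Definition atom_measure (A : set (borel_group G)) : \bar R :=
  (\esum_(x in A) (a^\+ x)%:E)%E.

Let atom_measure0 : atom_measure set0 = 0%E.
Proof. by rewrite /atom_measure esum_set0. Qed.

Let atom_measure_ge0 A : (0 <= atom_measure A)%E.
Proof. by apply: esum_ge0 => x _; rewrite lee_fin funrpos_ge0. Qed.

Let atom_measure_sigma_additive : semi_sigma_additive atom_measure.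
Proof.
move=> F mF tF mUF; rewrite /atom_measure nneseries_sum_bigcup//.
  by apply: is_cvg_nneseries => n _ _; exact: atom_measure_ge0.
by move=> x; rewrite lee_fin funrpos_ge0.
Qed.

HB.instance Definition _ := isMeasure.Build _ _ _ atom_measure
  atom_measure0 atom_measure_ge0 atom_measure_sigma_additive.

Hypothesis G_hausdorff : hausdorff_space G.

Lemma borel_set1 (x : G) : @measurable _ (borel_group G) [set x].
Proof. by have [] := relcompact_borel_finite G_hausdorff (finite_set1 x). Qed.

(** Outside the finite set s every point is a zero of g or an atom of mass 0, so
    g is almost everywhere equal to a finite combination of indicators of points
    of s. *)
Lemma integral_atom_measure_ge0 (g : borel_group G -> R) (s : seq G) :
  measurable_fun [set: borel_group G] g -> (forall x, 0 <= g x) -> uniq s ->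
  (forall x, x \notin s -> g x = 0 \/ a x = 0) ->
  (\int[atom_measure]_(x in [set: borel_group G]) (g x)%:E =
   (\sum_(x <- s) g x * a^\+ x)%:E)%E.
Proof.
move=> mg g0 us s0.
pose h (k : G) (x : borel_group G) : R := g k * \1_[set k] x.
have mh k : measurable_fun [set: borel_group G] (h k).
  apply: measurable_funM; first exact: measurable_cst.
  by apply: measurable_indic; exact: borel_set1.
have h0 k x : 0 <= h k x by rewrite mulr_ge0.
transitivity (\int[atom_measure]_(x in [set: borel_group G])
   (\sum_(k <- s) (h k x)%:E))%E.
  apply: ge0_ae_eq_integral => //.
  - exact/measurable_EFinP.
  - by apply: emeasurable_sum => k; exact/measurable_EFinP.
  - by move=> x _; rewrite lee_fin.
  - by move=> x _; apply: sume_ge0 => k _; rewrite lee_fin.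
  exists ([set x | g x != 0] `\` [set` s]); split.
  - apply: measurableD.
      have -> : [set x | g x != 0] =
          [set: borel_group G] `&` g @^-1` (~` [set 0]).
        by rewrite setTI; apply/seteqP; split=> x /= /eqP.
      by apply: mg => //; exact: measurableC.
    have fs : finite_set ([set` s] : set G) by [].
    by have [] := relcompact_borel_finite G_hausdorff fs.
  - apply: esum1 => x [/eqP gx /= /negP xs].
    by have [//|ax] := s0 x xs; rewrite /funrpos ax maxxx.
  - move=> x /= /not_implyP[_ gh]; split.
      apply/eqP => gx; apply: gh; rewrite gx big1// => k _.
      rewrite /h indicE; have [|_] := boolP (x \in [set k]).
        by rewrite inE => /= <-; rewrite gx mul0r.
      by rewrite mulr0.
    move=> xs; apply: gh.
    rewrite (bigD1_seq x)//= /h indicE mem_set// mulr1 big1 ?adde0// => k kx.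
    by rewrite indicE memNset ?mulr0//= => xk; rewrite xk eqxx in kx.
rewrite ge0_integral_sum//; last 2 first.
- by move=> k; exact/measurable_EFinP.
- by move=> k x _; rewrite lee_fin.
rewrite -sumEFin; apply: eq_bigr => k _.
under eq_integral do rewrite EFinM.
rewrite ge0_integralZl//=; last 2 first.
- by apply/measurable_EFinP/measurable_indic; exact: borel_set1.
- by rewrite lee_fin.
rewrite integral_indic//; last exact: borel_set1.
by rewrite setIT EFinM /= /atom_measure esum_set1// lee_fin funrpos_ge0.
Qed.

Lemma integral_atom_measure (g : borel_group G -> R) (s : seq G) :
  measurable_fun [set: borel_group G] g -> uniq s ->
  (forall x, x \notin s -> g x = 0 \/ a x = 0) ->
  (\int[atom_measure]_(x in [set: borel_group G]) (g x)%:E =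
   (\sum_(x <- s) g x * a^\+ x)%:E)%E.
Proof.
move=> mg us s0; rewrite integralE.
rewrite (eq_integral (fun x => (g^\+ x)%:E)); last first.
  by move=> x _; rewrite funeposE -EFin_max.
rewrite [X in (_ - X)%E](eq_integral (fun x => (g^\- x)%:E)); last first.
  by move=> x _; rewrite funenegE -EFinN -EFin_max.
have gE x : g^\+ x - g^\- x = g x.
  by have := congr1 (fun h => h x) (funrposBneg g).
rewrite (integral_atom_measure_ge0 (s := s))//; last 2 first.
- exact: measurable_funrpos.
- by move=> x /s0 [gx|]; [left; rewrite /funrpos gx maxxx|right].
rewrite (integral_atom_measure_ge0 (s := s))//; last 2 first.
- exact: measurable_funrneg.
- by move=> x /s0 [gx|]; [left; rewrite /funrneg gx oppr0 maxxx|right].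
rewrite -EFinB -sumrB; congr EFin; apply: eq_bigr => x _.
by rewrite -mulrBl gE.
Qed.

End atom_measure.

Lemma fsbig_seq_support (V : zmodType) (I : choiceType) (P : set I) (s : seq I)
    (F : I -> V) :
  uniq s -> [set` s] `<=` P -> (forall x, P x -> x \notin s -> F x = 0) ->
  \sum_(x \in P) F x = \sum_(x <- s) F x.
Proof.
move=> us sP Fs; rewrite (fsbigE s)// big_seq_cond [RHS]big_seq.
apply: eq_bigl => x; have [xs|//] := boolP (x \in s).
by rewrite mem_set//; exact: sP.
Qed.

Section atomic_on.
Context (R : realType) (G : topologicalZmodType) (L : set G).
Hypothesis G_hausdorff : hausdorff_space G.

Lemma atomic_on_comp (V W : zmodType) (phi : V -> W) (m : set G -> V) :
  {morph phi : x y / x + y} -> atomic_on L m -> atomic_on L (phi \o m).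
Proof.
move=> phiD mL A rA; have [fA mA] := mL A rA; split => //=.
have phi0 : phi 0 = 0 by apply: (addrI (phi 0)); rewrite -phiD !addr0.
by rewrite mA !fsbig_finite// (big_morph phi phiD phi0).
Qed.

(** The supremum of m B over B in A is approached by keeping finitely many atoms
    of positive mass, and no B does better than the sum of all of them. *)
Lemma pos_part_atomic (m : set G -> R) (A : set (borel_group G)) :
  atomic_on L m -> pos_part m A = atom_measure (fun x => m [set x]) A.
Proof.
move=> mL; apply/eqP; rewrite eq_le; apply/andP; split.
  apply: ge_ereal_sup => _ [B [rB BA] <-].
  have [fB ->] := mL B rB.
  apply: esum_ge; exists (B `&` L); first by split=> // x [/BA].
  rewrite fsbig_finite//= fsbig_finite//= sumEFin lee_fin.
  by apply: ler_sum => x _; rewrite /funrpos le_max lexx.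
apply: ge_ereal_sup => _ [X [fX XA] <-].
pose B := X `&` [set x | 0 < m [set x]].
have fB : finite_set B by apply: sub_finite_set fX => x [].
have rB := relcompact_borel_finite G_hausdorff fB.
apply: ereal_sup_ge; exists (m B)%:E.
  by exists B => //; split=> // x [/XA].
have [fBL ->] := mL B rB.
rewrite (fsbig_widen (B `&` L) B); last 2 first.
- by move=> x [].
- move=> x [Bx nLx].
  by rewrite /= (atomic_on_set1 G_hausdorff mL)// => Lx; apply: nLx.
rewrite -(fsbig_widen B X); last 2 first.
- by move=> x [].
- move=> x [Xx nB] /=; congr EFin; rewrite /funrpos; apply/max_idPr.
  by rewrite leNgt; apply/negP => m0; apply: nB.
rewrite !fsbig_finite//= sumEFin lee_fin big_seq [X in _ <= X]big_seq.
apply: ler_sum => x; rewrite in_fset_set// inE => -[_ /= /ltW m0].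
by rewrite /funrpos (max_idPl m0).
Qed.

Lemma continuous_borel_measurable (f : G -> R) : continuous f ->
  measurable_fun [set: borel_group G] (f : borel_group G -> R).
Proof.
move=> /continuousP cf; apply: (measurability _ (RGenOpens.measurableE R)).
move=> _ [_ [a [b ->] <-]]; rewrite setTI; apply: borel_open.
exact/cf/interval_open.
Qed.

Lemma real_integral_atomic (m : set G -> R) (f : G -> R) (s : seq G) :
  atomic_on L m -> continuous f -> uniq s ->
  (forall x, x \notin s -> f x = 0 \/ m [set x] = 0) ->
  real_integral m f = \sum_(x <- s) f x * m [set x].
Proof.
move=> mL cf us s0.
have mNL : atomic_on L (fun A => - m A).
  by apply: (atomic_on_comp (phi := -%R)) mL; exact: opprD.
have mf := continuous_borel_measurable cf.
rewrite /real_integral /neg_part.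
rewrite (funext (fun A => pos_part_atomic A mL)).
rewrite (funext (fun A => pos_part_atomic A mNL)).
rewrite (integral_atom_measure G_hausdorff (s := s))//.
rewrite (integral_atom_measure G_hausdorff (s := s))//; last first.
  by move=> x /s0[|->]; [left|right; rewrite oppr0].
rewrite /= -sumrB; apply: eq_bigr => x _; rewrite -mulrBr; congr (_ * _).
exact: (congr1 (fun h => h x) (funrposBneg (fun x => m [set x]))).
Qed.

Lemma complex_integral_atomic (mu : set G -> R[i]) (f : G -> R[i]^o)
    (s : seq G) :
  atomic_on L mu -> continuous f -> uniq s ->
  (forall x, x \notin s -> f x = 0 \/ mu [set x] = 0) ->
  complex_integral mu f = \sum_(x <- s) f x * mu [set x].
Proof.
move=> muL cf us s0; rewrite /complex_integral.
have reL : atomic_on L (fun A => complex.Re (mu A)).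
  by apply: (atomic_on_comp (phi := @complex.Re R)) muL => -[a b] [c d].
have imL : atomic_on L (fun A => complex.Im (mu A)).
  by apply: (atomic_on_comp (phi := @complex.Im R)) muL => -[a b] [c d].
have cre : continuous (fun x => complex.Re (f x)).
  by move=> x; apply: (cvg_comp _ (@complex.Re R) (cf x)); exact: continuous_Re.
have cim : continuous (fun x => complex.Im (f x)).
  by move=> x; apply: (cvg_comp _ (@complex.Im R) (cf x)); exact: continuous_Im.
have h x : x \notin s -> (complex.Re (f x) = 0 /\ complex.Im (f x) = 0) \/
    (complex.Re (mu [set x]) = 0 /\ complex.Im (mu [set x]) = 0).
  by move=> /s0[->|->]; [left|right].
rewrite !(real_integral_atomic _ _ us) => //; try by move=> x /h [[]|[]]; auto.
elim: (s) => [|x r IH]; first by rewrite !big_nil subrr addr0.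
rewrite !big_cons -IH; case: (f x) => a b; case: (mu [set x]) => c d /=.
by apply/eqP; rewrite eq_complex /=; apply/andP; split; apply/eqP; ring.
Qed.

Lemma convolution_atomic (mu : set G -> R[i]) (f : G -> R[i]^o) (K : set G) :
  atomic_on L mu -> continuous f -> compact K -> (forall x, ~ K x -> f x = 0) ->
  forall x, convolution f mu x = \sum_(y \in [set: G]) f (x - y) * mu [set y].
Proof.
move=> muL cf cK fK x.
have cK' : compact [set y | K (x - y)] by exact: compact_reflect.
have [fS _] := muL _ (relcompact_borel_compact G_hausdorff cK').
set s := finmap.enum_fset (fset_set ([set y | K (x - y)] `&` L)).
have us : uniq s by exact: finmap.fset_uniq.
have s0 y : y \notin s -> f (x - y) = 0 \/ mu [set y] = 0.
  rewrite in_fset_set// notin_setE => /not_andP[/fK|nLy]; [by left|right].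
  exact: (atomic_on_set1 G_hausdorff muL nLy).
rewrite (fsbig_seq_support us)//; last first.
  by move=> y _ /s0[->|->]; rewrite ?mul0r ?mulr0.
apply: (complex_integral_atomic (f := fun y => f (x - y)) muL _ us s0) => y.
by apply: (cvg_comp _ f); [exact: continuous_reflect|exact: cf].
Qed.

End atomic_on.

(** * Convolutions of measures that come close to infinity *)

(** The value at x is a sum over the l such that l or sigma l lies in x - S.
    There are at most N1 + N2 of them, with N1 and N2 independent of x. Once x
    has left K + S, all these l and sigma l lie outside K, so that
      f (x - l) mu(l) - f (x - sigma l) nu(sigma l)
        = (f (x - l) - f (x - sigma l)) mu(l)
          + f (x - sigma l) (mu(l) - nu(sigma l))
    is small by uniform continuity of f and the bounds on the atoms and on f. *)
Lemma close_convolution_vanish (R : realType) (G : topologicalZmodType)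
    (mu nu : set G -> R[i]) (f : G -> R[i]^o) (S : set G) :
  hausdorff_space G -> DM mu -> DM nu -> translation_bounded mu ->
  come_close_to_infinity mu nu ->
  continuous f -> compact S -> (forall x, ~ S x -> f x = 0) ->
  forall e : R, 0 < e -> exists2 K : set G, compact K & forall x, ~ K x ->
    normc (convolution f mu x - convolution f nu x) < e.
Proof.
move=> G_hausdorff mu_DM nu_DM mu_tb [sigma [sigma_bij close]] cf cS fS e e0.
have mu_at := DM_atomic G_hausdorff mu_DM.
have nu_at := DM_atomic G_hausdorff nu_DM.
have [C fC] := compact_support_bounded cf cS fS.
have [M muM] := translation_bounded_atoms G_hausdorff mu_tb.
have C0 : 0 <= C by exact: le_trans (normc_ge0 _) (fC 0).
have M0 : 0 <= M by exact: le_trans (normc_ge0 _) (muM 0).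
have [N1 count1] := DM_count mu_DM cS.
have [N2 count2] := DM_count nu_DM cS.
(* The tolerance d makes (N1 + N2) * d * (M + C) < e; adding 1 to both factors
   keeps the denominator positive when M, C, N1 and N2 vanish. *)
pose d := e / ((M + C + 1) * (N1 + N2).+1%:R).
have d0 : 0 < d by rewrite divr_gt0// mulr_gt0// ltr_wpDl// addr_ge0.
have [V nV fV] := compact_support_unif_continuous cf cS fS d0.
have [K cK closeK] := close d _ d0 (nbhs_opp0 nV).
exists [set x | exists2 k, K k & S (x - k)]; first exact: compact_add.
move=> x nKx.
have S_out y : S (x - y) -> ~ K y by move=> Sxy Ky; apply: nKx; exists y.
have [sigma_fun sigma_inj sigma_surj] := sigma_bij.
(* A section g of sigma, to index the terms seen by nu by points of supp mu. *)
have /choice[g gP] y : exists l, supp nu y -> supp mu l /\ sigma l = y.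
  have [/sigma_surj[l sl <-]|ny] := pselect (supp nu y); first by exists l.
  by exists 0 => /ny.
have [s1 [s1N s1P]] := count1 x; have [s2 [s2N s2P]] := count2 x.
pose s := [seq l <- undup (s1 ++ map g s2) | l \in supp mu].
have us : uniq s by rewrite filter_uniq// undup_uniq.
have s_mu l : l \in s -> supp mu l by rewrite mem_filter => /andP[/set_mem].
have s_size : (size s <= N1 + N2)%N.
  rewrite (leq_trans (size_subseq (filter_subseq _ _)))//.
  by rewrite (leq_trans (size_undup _))// size_cat size_map leq_add.
have s_out l : supp mu l -> l \notin s -> ~ S (x - l) /\ ~ S (x - sigma l).
  move=> mul; rewrite mem_filter mem_set//= mem_undup mem_cat => /norP[l1 l2].
  split => Sl; first by rewrite (s1P l mul Sl) in l1.
  have nul : supp nu (sigma l) by exact: sigma_fun.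
  have [mug sg] := gP _ nul.
  have gl : g (sigma l) = l by apply: sigma_inj; rewrite ?inE.
  by move: l2; rewrite -gl map_f// s2P.
have -> : convolution f mu x = \sum_(l <- s) f (x - l) * mu [set l].
  rewrite (convolution_atomic G_hausdorff mu_at cf cS fS).
  rewrite -(fsbig_widen (supp mu))//; last first.
    by move=> l [_ nl] /=; rewrite (atomic_on_set1 G_hausdorff mu_at nl) mulr0.
  rewrite (fsbig_seq_support us)// => l mul ls.
  by rewrite fS ?mul0r//; have [] := s_out l mul ls.
have -> : convolution f nu x = \sum_(l <- s) f (x - sigma l) * nu [set sigma l].
  rewrite (convolution_atomic G_hausdorff nu_at cf cS fS).
  rewrite -(fsbig_widen (supp nu))//; last first.
    by move=> l [_ nl] /=; rewrite (atomic_on_set1 G_hausdorff nu_at nl) mulr0.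
  rewrite (reindex_fsbig sigma (supp mu))//.
  rewrite (fsbig_seq_support us)// => l mul ls.
  by rewrite fS ?mul0r//; have [] := s_out l mul ls.
rewrite -sumrB.
have term l : l \in s -> normc (f (x - l) * mu [set l] -
    f (x - sigma l) * nu [set sigma l]) <= d * (M + C).
  move=> ls; have mul := s_mu l ls.
  have [nearK|] := pselect ((supp mu `\` K) l \/ (supp nu `\` K) (sigma l)).
    have [Vl /ltW dl] := closeK l mul nearK.
    have /ltW fl : normc (f (x - l) - f (x - sigma l)) < d.
      by apply: fV; rewrite opprB addrC -addrA addKr -opprB.
    rewrite (_ : _ - _ = (f (x - l) - f (x - sigma l)) * mu [set l] +
      f (x - sigma l) * (mu [set l] - nu [set sigma l])); last by ring.
    rewrite (le_trans (ler_normcD _ _))// [leRHS]mulrDr.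
    rewrite !ComplexField.Normc.normcM.
    by rewrite lerD// ?[d * C]mulrC ler_pM ?normc_ge0.
  move=> /not_orP[n1 n2].
  have -> : f (x - l) = 0.
    by apply: fS => /S_out nK; apply: n1; split.
  have -> : f (x - sigma l) = 0.
    by apply: fS => /S_out nK; apply: n2; split => //; exact: sigma_fun.
  rewrite !mul0r subrr ComplexField.Normc.normc0 mulr_ge0//; first exact: ltW.
  exact: addr_ge0.
rewrite (le_lt_trans (normc_sum_le term))//.
have -> : e = d * ((M + C + 1) * (N1 + N2).+1%:R).
  by rewrite divfK// mulf_neq0// gt_eqF// ltr_wpDl// addr_ge0.
rewrite -[ltLHS]mulr_natr -mulrA ltr_pM2l//.
apply: (@le_lt_trans _ _ ((M + C) * (N1 + N2)%:R)).
  by rewrite ler_wpM2l ?addr_ge0// ler_nat.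
have : 0 <= (N1 + N2)%:R :> R by [].
rewrite -natr1; move: (_%:R) => b b0; lra.
Qed.

Theorem theorem2 (R : realType) (G : topologicalZmodType)
    (G_hausdorff : hausdorff_space G)
    (G_locally_compact : locally_compact [set: G])
    (G_second_countable : @second_countable G)
    (G_sigma_compact : sigma_compact G)
    (G_not_compact : ~ compact [set: G])
    (mu nu : set G -> R[i])
    (mu_DM : DM mu) (nu_DM : DM nu)
    (mu_ap : almost_periodic_measure mu) (nu_ap : almost_periodic_measure nu)
    (mu_tb : translation_bounded mu) (nu_tb : translation_bounded nu)
    (mu_nu_close : come_close_to_infinity mu nu) :
  measure_eq mu nu.
Proof.
have mu_at := DM_atomic G_hausdorff mu_DM.
have nu_at := DM_atomic G_hausdorff nu_DM.
(* Both measures are the sums of their atoms. *)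
suff atoms l : mu [set l] = nu [set l].
  move=> A rA; rewrite (atomic_onE G_hausdorff mu_at rA).
  by rewrite (atomic_onE G_hausdorff nu_at rA); apply: eq_fsbigr => l _.
have finL K : compact K -> finite_set (K `&` (supp mu `|` supp nu)).
  by move=> cK; rewrite setIUr finite_setU; split; exact: DM_compact_finite.
have [f [fc f0 fl]] := isolating_bump R l G_hausdorff G_locally_compact finL.
have [cf cS] := fc.
have fS x : ~ closure [set x | f x != 0] x -> f x = 0.
  by apply: contra_notP => /eqP fx; exact: subset_closure.
have conv_l (m : set G -> R[i]) L : L `<=` supp mu `|` supp nu ->
    atomic_on L m -> convolution f m l = m [set l].
  move=> Lsub mL; rewrite (convolution_atomic G_hausdorff mL cf cS fS).
  rewrite (fsbig_seq_support (s := [:: l]))//.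
    by rewrite big_seq1 subrr f0 mul1r.
  move=> y _; rewrite inE => /eqP yl.
  have [Ly|nLy] := pselect (L y); first by rewrite fl ?mul0r//; exact: Lsub.
  by rewrite (atomic_on_set1 G_hausdorff mL nLy) mulr0.
rewrite -(conv_l mu _ (@subsetUl _ _ _) mu_at).
rewrite -(conv_l nu _ (@subsetUr _ _ _) nu_at).
apply: (almost_periodic_eq G_not_compact (mu_ap f fc) (nu_ap f fc)).
exact: close_convolution_vanish cf cS fS.
Qed.
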